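(* Let $f:\mathbb{R}^m\to\mathbb{R}$ be convex and $(M,\nu)$-Hölder smooth on $\mathbb{R}^m$ with $M>0$ and $\nu\in[0,1]$, consider $p^*=\min_{y\in\mathbb{R}^n}\{p(y)=f(Ay)+g(y)\}$ in the setting of the context with $D>0$, and let $r:=MD^{\nu-1}$. Let $b\ge2$ be a constant. If the integer budget $N$ satisfies $$N\ge N^*:=\max\left\{4b\log_2(4b),\ (8r^2)^{\frac{1}{b-1+\nu}},\ (8/r^2)^{\frac1b}\right\}\ \ (\ge 24),$$ then the output $\hat y_N$ of the Fixed-Budget Parameter Search algorithm of the context, run with budget $N$ and constant $b$, satisfies $$p(\hat y_N)-p^*\le262\,MD^{\nu+1}\left(\frac{2b\log_2N}{N}\right)^{\frac{1+\nu}{2}}.$$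
   Context: $\|\cdot\|$ is the Euclidean norm. Setting: $A:\mathbb{R}^n\to\mathbb{R}^m$ is linear; $g:\mathbb{R}^n\to\mathbb{R}\cup\{+\infty\}$ is proper, closed and convex; for every $\lambda\in\mathbb{R}^n$ the problem $\min_{y\in\mathbb{R}^n}\{\langle\lambda,y\rangle+g(y)\}$ has an optimal solution; the set $A(\mathrm{dom}\,g)$ is bounded, and $D:=\sup_{x,z\in A(\mathrm{dom}\,g)}\|x-z\|<+\infty$. A convex $f:\mathbb{R}^m\to\mathbb{R}$ is $(M,\nu)$-Hölder smooth on $\mathbb{R}^m$ if $0\le f(x)-f(z)-\langle s_z,x-z\rangle\le\frac{M}{1+\nu}\|x-z\|^{1+\nu}$ for all $x,z\in\mathbb{R}^m$ and all $s_z\in\partial f(z)$. First-order primal-dual splitting method with positive parameters $\{\eta_k\}_{k\ge0},\{\rho_k\}_{k\ge0}$: given $y_0\in\mathrm{dom}\,g$, set $x_0=Ay_0$ and $\lambda_0\in\partial f(x_0)$; for $k=0,1,2,\dots,K-1$: (i) $y_{k+1}\in\arg\min_{y\in\mathbb{R}^n}\,g(y)+\langle\lambda_k,Ay\rangle$ (one linear-minimization-oracle, LMO, call); (ii) choose $s_k\in\partial f(x_k)$; (iii) $x_{k+1}=\arg\min_{x\in\mathbb{R}^m}\langle s_k-\lambda_k,x\rangle+\frac{\eta_k}{2}\|x-x_k\|^2+\frac{\rho_k}{2}\|Ay_{k+1}-x\|^2$; (iv) $\lambda_{k+1}=\lambda_k+\rho_k(Ay_{k+1}-x_{k+1})$.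 All choices among minimizers and subgradients are arbitrary. The output after $K$ iterations is $\bar y_K:=\frac{\sum_{i=0}^{K-1}\alpha_iy_{i+1}}{\sum_{i=0}^{K-1}\alpha_i}$ with $\alpha_i=i+2$. Fixed-Budget Parameter Search with input $y_0\in\mathrm{dom}\,g$, budget $N$ and constant $b\ge2$: set $K:=\lfloor N/(b\log_2N)\rfloor$ and $s:=\lfloor(N/K-1)/2\rfloor$. For each integer $j=-s,\dots,s$, run the first-order primal-dual splitting method for $K$ iterations from $y_0$ with $\eta_k\equiv\eta^j:=2^j$ and $\rho_k=\frac{4\eta^j}{k+1}$ for all $k\ge 0$, and denote its output by $\bar y_K^j$. Output $\hat y_N:=\bar y_K^{j^*}$ where $j^*\in\arg\min_{-s\le j\le s}p(\bar y_K^j)$. *)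

(* Defs.v *)
From HB Require Import structures.
From mathcomp Require Import all_boot all_order all_algebra.
From mathcomp Require Import all_classical all_reals all_analysis.

Set Implicit Arguments.
Unset Strict Implicit.
Unset Printing Implicit Defensive.

Import Order.TTheory GRing.Theory Num.Theory.
Import numFieldNormedType.Exports.

Local Open Scope classical_set_scope.
Local Open Scope ring_scope.

(* The library norm on matrices is the max norm, so the Euclidean structure on
   column vectors is introduced here. *)
Definition inner (R : realType) (n : nat) (u v : 'cV[R]_n) : R :=
  \sum_(i < n) u i 0 * v i 0.

Definition enorm (R : realType) (n : nat) (u : 'cV[R]_n) : R :=
  Num.sqrt (inner u u).

Definition ebounded (R : realType) (n : nat) (S : set 'cV[R]_n) : Prop :=
  exists C : R, forall x, S x -> enorm x <= C.

(* A junk value when [S] is empty or unbounded, as for any [sup] in [R]. *)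
Definition ediam (R : realType) (n : nat) (S : set 'cV[R]_n) : R :=
  sup [set d | exists x z, [/\ S x, S z & d = enorm (x - z)]].

Definition log2 (R : realType) (x : R) : R := ln x / ln 2.

Definition argmin (disp : Order.disp_t) (V : porderType disp) (T : Type)
    (S : set T) (F : T -> V) : set T :=
  [set x | S x /\ forall z, S z -> (F x <= F z)%O].

Definition edom (R : realType) (T : Type) (g : T -> \bar R) : set T :=
  [set y | (g y < +oo)%E].

Definition epigraph (R : realType) (n : nat) (g : 'cV[R]_n -> \bar R) :
    set ('cV[R]_n * R^o) :=
  [set q | (g q.1 <= (q.2 : R)%:E)%E].

Definition proper_efun (R : realType) (T : Type) (g : T -> \bar R) : Prop :=
  (forall y, g y != -oo%E) /\ edom g !=set0.

Definition closed_efun (R : realType) (n : nat) (g : 'cV[R]_n -> \bar R) : Prop :=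
  closed (epigraph g).

Definition convex_efun (R : realType) (n : nat) (g : 'cV[R]_n -> \bar R) : Prop :=
  convex_set (epigraph g : set (convex_lmodType ('cV[R]_n * R^o)%type)).

Definition convex_fun (R : realType) (m : nat) (f : 'cV[R]_m -> R) : Prop :=
  convex_function (setT : set (convex_lmodType 'cV[R]_m)) f.

Definition subdiff (R : realType) (m : nat) (f : 'cV[R]_m -> R)
    (z : 'cV[R]_m) : set 'cV[R]_m :=
  [set s | forall x, f z + inner s (x - z) <= f x].

Definition holder_smooth (R : realType) (m : nat) (f : 'cV[R]_m -> R)
    (M nu : R) : Prop :=
  forall x z s, subdiff f z s ->
    0 <= f x - f z - inner s (x - z)
      <= M / (1 + nu) * enorm (x - z) `^ (1 + nu).

Definition lmo_solvable (R : realType) (n : nat) (g : 'cV[R]_n -> \bar R) : Prop :=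
  forall l : 'cV[R]_n,
    argmin setT (fun y => ((inner l y)%:E + g y)%E) !=set0.

Definition objective (R : realType) (n m : nat)
    (A : {linear 'cV[R]_n -> 'cV[R]_m}) (f : 'cV[R]_m -> R)
    (g : 'cV[R]_n -> \bar R) (y : 'cV[R]_n) : \bar R :=
  ((f (A y))%:E + g y)%E.

Definition optimal_value (R : realType) (n m : nat)
    (A : {linear 'cV[R]_n -> 'cV[R]_m}) (f : 'cV[R]_m -> R)
    (g : 'cV[R]_n -> \bar R) : \bar R :=
  ereal_inf (range (objective A f g)).

(* [splitting_run A f g eta rho y0 K y x l s]: the first [K] iterations recorded
   in the sequences [y], [x], [l] (multipliers) and [s] (subgradients) form an
   execution of the primal-dual splitting method started at [y0]. It is a
   relation because minimizers and subgradients are chosen arbitrarily. *)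
Record splitting_run (R : realType) (n m : nat)
    (A : {linear 'cV[R]_n -> 'cV[R]_m}) (f : 'cV[R]_m -> R)
    (g : 'cV[R]_n -> \bar R) (eta rho : nat -> R) (y0 : 'cV[R]_n) (K : nat)
    (y : nat -> 'cV[R]_n) (x l s : nat -> 'cV[R]_m) : Prop := SplittingRun {
  run_y0 : y 0 = y0 ;
  run_x0 : x 0 = A y0 ;
  run_l0 : subdiff f (x 0) (l 0) ;
  run_y : forall k, (k < K)%N ->
    argmin setT (fun v => (g v + (inner (l k) (A v))%:E)%E) (y k.+1) ;
  run_s : forall k, (k < K)%N -> subdiff f (x k) (s k) ;
  run_x : forall k, (k < K)%N ->
    argmin setT (fun u : 'cV[R]_m =>
      inner (s k - l k) u + eta k / 2 * enorm (u - x k) ^+ 2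
      + rho k / 2 * enorm (A (y k.+1) - u) ^+ 2) (x k.+1) ;
  run_l : forall k, (k < K)%N ->
    l k.+1 = l k + rho k *: (A (y k.+1) - x k.+1)
}.

Definition averaged_output (R : realType) (n : nat) (K : nat)
    (y : nat -> 'cV[R]_n) : 'cV[R]_n :=
  (\sum_(0 <= i < K) (i + 2)%:R)^-1 *: \sum_(0 <= i < K) (i + 2)%:R *: y i.+1.

Definition splitting_output (R : realType) (n m : nat)
    (A : {linear 'cV[R]_n -> 'cV[R]_m}) (f : 'cV[R]_m -> R)
    (g : 'cV[R]_n -> \bar R) (eta rho : nat -> R) (y0 : 'cV[R]_n) (K : nat)
    (ybar : 'cV[R]_n) : Prop :=
  exists y x l s, splitting_run A f g eta rho y0 K y x l s /\
    ybar = averaged_output K y.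

(* [Num.truncn] is the floor on nonnegative reals. *)
Definition search_iters (R : realType) (N : nat) (b : R) : nat :=
  Num.truncn (N%:R / (b * log2 N%:R)).

Definition search_radius (R : realType) (N : nat) (b : R) : int :=
  Num.floor ((N%:R / (search_iters N b)%:R - 1) / 2 : R).

Definition search_output (R : realType) (n m : nat)
    (A : {linear 'cV[R]_n -> 'cV[R]_m}) (f : 'cV[R]_m -> R)
    (g : 'cV[R]_n -> \bar R) (y0 : 'cV[R]_n) (N : nat) (b : R)
    (yhat : 'cV[R]_n) : Prop :=
  let K := search_iters N b in
  let s := search_radius N b in
  exists ybar : int -> 'cV[R]_n,
    (forall j : int, - s <= j <= s ->
       let eta : R := 2 ^ j in
       splitting_output A f g (fun=> eta) (fun k => 4 * eta / k.+1%:R)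
         y0 K (ybar j)) /\
    exists2 jstar : int,
      argmin [set j : int | - s <= j <= s]
        (fun j => objective A f g (ybar j)) jstar
      & yhat = ybar jstar.

Definition budget_threshold (R : realType) (b nu r : R) : R :=
  Num.max (4 * b * log2 (4 * b))
    (Num.max ((8 * r ^+ 2) `^ (1 / (b - 1 + nu))) ((8 / r ^+ 2) `^ (1 / b))).

(* Main.v *)
(** Fix a comparison point v, write w = A v and w_k = A y_k, and let lam be a
    subgradient of f at the image wbar of the averaged output.  The optimality
    condition of the proximal step says l_(k+1) = s_k + eta (x_(k+1) - x_k), and with
    weights k + 2 and rho_k = 4 eta / (k + 1) the potential
    (k+1)(k+2)/(8 eta) |lam - l_k|^2 + (k+2) eta/2 |x_k - w|^2 decreases up to the
    error 4 eta D^2 + (k + 2) e at each step, provided f is L-smooth up to the error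
    e and eta >= L.  The linear terms <lam, wbar - w_(k+1)> average to zero.  For a
    Hoelder smooth f, Young's inequality at the scale D / sqrt K gives
    L = r K^((1-nu)/2); the threshold on N guarantees that the dyadic grid of the
    search contains some 2^j in [L, 2L], and the corresponding run has error at
    most 17 M D^(1+nu) K^(-(1+nu)/2). *)

Require Import Defs.
From mathcomp Require Import all_boot all_order all_algebra.
From mathcomp Require Import all_classical all_reals all_analysis.
From mathcomp Require Import ring lra.

Import Order.TTheory GRing.Theory Num.Theory.
Import numFieldNormedType.Exports.

Set Implicit Arguments.
Unset Strict Implicit.
Unset Printing Implicit Defensive.

Local Open Scope classical_set_scope.
Local Open Scope ring_scope.

(** * Euclidean inner product and norm *)

Lemma innerC (R : realType) m (u v : 'cV[R]_m) : inner u v = inner v u.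
Proof. by apply: eq_bigr => i _; rewrite mulrC. Qed.

Lemma innerDl (R : realType) m (u v w : 'cV[R]_m) :
  inner (u + v) w = inner u w + inner v w.
Proof. by rewrite -big_split; apply: eq_bigr => i _; rewrite mxE mulrDl. Qed.

Lemma innerZl (R : realType) m a (u w : 'cV[R]_m) :
  inner (a *: u) w = a * inner u w.
Proof. by rewrite /inner mulr_sumr; apply: eq_bigr => i _; rewrite mxE mulrA. Qed.

Lemma innerDr (R : realType) m (u v w : 'cV[R]_m) :
  inner w (u + v) = inner w u + inner w v.
Proof. by rewrite innerC innerDl !(innerC _ w). Qed.

Lemma innerZr (R : realType) m a (u w : 'cV[R]_m) :
  inner w (a *: u) = a * inner w u.
Proof. by rewrite innerC innerZl innerC. Qed.

Lemma innerNl (R : realType) m (u w : 'cV[R]_m) : inner (- u) w = - inner u w.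
Proof. by rewrite -scaleN1r innerZl mulN1r. Qed.

Lemma innerNr (R : realType) m (u w : 'cV[R]_m) : inner w (- u) = - inner w u.
Proof. by rewrite innerC innerNl innerC. Qed.

Lemma inner0r (R : realType) m (w : 'cV[R]_m) : inner w 0 = 0.
Proof. by rewrite -(scale0r 0) innerZr mul0r. Qed.

Definition inner_bilin := (innerDl, innerDr, innerNl, innerNr, innerZl, innerZr).

Lemma inner_sumr (R : realType) m I (r : seq I) (F : I -> 'cV[R]_m) (w : 'cV[R]_m) :
  inner w (\sum_(i <- r) F i) = \sum_(i <- r) inner w (F i).
Proof.
by elim/big_rec2: _ => [|i a b _ <-]; [exact: inner0r | rewrite innerDr].
Qed.

Lemma inner_ge0 (R : realType) m (u : 'cV[R]_m) : 0 <= inner u u.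
Proof. by apply: sumr_ge0 => i _; rewrite -expr2 sqr_ge0. Qed.

Lemma inner_eq0 (R : realType) m (u : 'cV[R]_m) : inner u u = 0 -> u = 0.
Proof.
move=> u0; apply/colP => i; rewrite mxE; apply/eqP; rewrite -sqrf_eq0 expr2.
move: u0 => /eqP; rewrite psumr_eq0 => [/allP/(_ i)|j _]; last by rewrite -expr2 sqr_ge0.
by rewrite mem_index_enum => /(_ isT).
Qed.

Lemma enorm_ge0 (R : realType) m (u : 'cV[R]_m) : 0 <= enorm u.
Proof. exact: sqrtr_ge0. Qed.

Lemma enorm_sqr (R : realType) m (u : 'cV[R]_m) : enorm u ^+ 2 = inner u u.
Proof. by rewrite sqr_sqrtr ?inner_ge0. Qed.

(** * First-order condition of the proximal step and the one-step identity *)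

Lemma quadratic_min_derivative (R : realType) (a c : R) :
  (forall t, 0 <= t * a + t ^+ 2 * c) -> a = 0.
Proof.
move=> H; have cc : c <= `|c| := ler_norm c; have cge0 := normr_ge0 c.
set d := 1 + `|c|; have d0 : 0 < d by rewrite /d; lra.
(* At this [t] the quadratic equals [- a^2 (2 d - c) / (2 d)^2], and [2 d - c > 0] by the choice of
   [d]. *)
have := H (- a / (2 * d)).
have -> : - a / (2 * d) * a + (- a / (2 * d)) ^+ 2 * c
        = - (a ^+ 2 * (2 * d - c)) / (2 * d) ^+ 2 by field; rewrite gt_eqF.
rewrite pmulr_lge0 ?invr_gt0 ?exprn_gt0 ?mulr_gt0// oppr_ge0 pmulr_lle0; last first.
  by rewrite /d; lra.
by move=> /(conj (sqr_ge0 a))/andP/le_anti/esym/eqP; rewrite sqrf_eq0 => /eqP.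
Qed.

(** Minimality is tested along the gradient [d] itself: moving by [t *: d] changes the objective by
    [t <d, d> + t^2 (eta + rho) / 2 <d, d>], which forces [<d, d> = 0]. *)
Lemma prox_optimality (R : realType) m (q x w x' : 'cV[R]_m) (eta rho : R) :
  argmin setT (fun u : 'cV[R]_m => inner q u + eta / 2 * enorm (u - x) ^+ 2
                                 + rho / 2 * enorm (w - u) ^+ 2) x' ->
  q + eta *: (x' - x) + rho *: (x' - w) = 0.
Proof.
move=> [_ opt]; set d := (LHS); apply: inner_eq0.
have dE e : inner d e = inner q e + eta * inner (x' - x) e + rho * inner (x' - w) e.
  by rewrite /d innerDl innerDl !innerZl.
clearbody d; have dd := dE d.
apply: (@quadratic_min_derivative _ _ ((eta + rho) / 2 * inner d d)) => t.
have := opt (x' + t *: d) I; rewrite !enorm_sqr -subr_ge0.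
move=> /le_trans; apply; rewrite le_eqVlt; apply/orP; left; apply/eqP.
have -> : x' + t *: d - x = (x' - x) + t *: d by rewrite addrAC.
have -> : w - (x' + t *: d) = - ((x' - w) + t *: d) by rewrite !opprD !opprK addrA (addrC w).
rewrite -(opprB x' w) dd; move: dd; move: (x' - x) (x' - w) => a c dd.
rewrite !inner_bilin dd (innerC d a) (innerC d c); by field.
Qed.

(* In the coordinates q = lam - l', a = x' - x, p = w' - x', z = w - x' the two
   relations on the iterates give lam - l = q + rho p, l - s = eta a - rho p and
   lam - s = q + eta a; the cross terms in <q, a> then cancel exactly. *)
Lemma splitting_step_gap (R : realType) m
    (lam l l' s x x' w w' : 'cV[R]_m) (eta rho : R) :
  0 < eta -> 0 < rho ->
  l' = l + rho *: (w' - x') ->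
  s - l + eta *: (x' - x) + rho *: (x' - w') = 0 ->
  inner (lam - l) (w' - x) + inner (l - s) (w - x)
    - inner (lam - s) (lam - s) / (2 * eta)
  = (inner (lam - l) (lam - l) - inner (lam - l') (lam - l')) / (2 * rho)
    - inner (lam - l') (lam - l') / (2 * eta)
    + eta / 2 * (inner (x - w) (x - w) - inner (x' - w) (x' - w))
    + rho / 2 * (inner (w' - w) (w' - w) - inner (x' - w) (x' - w)).
Proof.
move=> eta0 rho0 El Ex.
pose q := lam - l'; pose a := x' - x; pose p := w' - x'; pose z := w - x'.
have El1 : lam - l = q + rho *: p by apply/colP => i; rewrite /q El !mxE; ring.
have Els : l - s = eta *: a - rho *: p.
  by apply/colP => i; move/colP/(_ i): Ex; rewrite !mxE; lra.
have Elams : lam - s = q + eta *: a.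
  by apply/colP => i; move/colP/(_ i): Ex; rewrite /q El !mxE; lra.
have -> : w' - x = p + a by rewrite /p /a addrA subrK.
have Ewx : w - x = z + a by rewrite /z /a addrA subrK.
have -> : x - w = - (z + a) by rewrite -Ewx opprB.
have -> : x' - w = - z by rewrite opprB.
have -> : w' - w = p - z by rewrite /p /z opprB addrA subrK.
rewrite Ewx El1 Els Elams -/q; move: q a p z {El1 Els Elams Ewx} => q a p z.
rewrite !inner_bilin.
rewrite !(innerC _ q) (innerC p a) (innerC a z) (innerC p z).
by field; rewrite !gt_eqF.
Qed.

(** * Inexact quadratic bounds from Hölder smoothness *)

(** Weighted arithmetic-geometric mean of [v] and 1. The tangent to [ln] at the mean [B] is
    evaluated at [v] and at 1; with weights [a] and [1 - a] the right-hand sides cancel. *)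
Lemma powR_le_affine (R : realType) (a v : R) :
  0 <= a <= 1 -> 0 < v -> v `^ a <= a * v + (1 - a).
Proof.
move=> /andP[a0 a1] v0; set B := a * v + _.
have B0 : 0 < B.
  have [a_eq0|a_neq0] := eqVneq a 0; first by rewrite /B a_eq0; lra.
  have : 0 < a * v by rewrite mulr_gt0// lt0r a_neq0.
  by rewrite /B; lra.
rewrite -ler_ln ?posrE ?powR_gt0// ln_powR.
have ln_le w : 0 < w -> ln w - ln B <= w / B - 1.
  move=> w0; rewrite -ln_div ?posrE// -{1}(subrK 1 (w / B)) addrC.
  by apply: le_ln1Dx; rewrite ltrBDr addrC subrr divr_gt0.
have H1 := ler_wpM2l a0 (ln_le _ v0).
have a1' : 0 <= 1 - a by lra.
have := ler_wpM2l a1' (ln_le _ ltr01); rewrite ln1.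
have : a * (v / B - 1) + (1 - a) * (1 / B - 1) = 0.
  have -> : a * (v / B - 1) + (1 - a) * (1 / B - 1) = B / B - 1.
    by rewrite /B; field; rewrite gt_eqF.
  by rewrite divff ?subrr// gt_eqF.
lra.
Qed.

(* The sharp additive term is M eps^(1+nu) (1-nu)/(2(1+nu)). *)
Lemma holder_power_le_quadratic (R : realType) (M nu eps t : R) :
  0 <= M -> 0 <= nu <= 1 -> 0 < eps -> 0 <= t ->
  M / (1 + nu) * t `^ (1 + nu)
    <= M * eps `^ (nu - 1) / 2 * t ^+ 2 + M * eps `^ (1 + nu) / 2.
Proof.
move=> M0 /andP[nu0 nu1] eps0; rewrite le0r => /orP[/eqP->|t0].
  rewrite powR0 ?gt_eqF//; last by lra.
  by rewrite mulr0 expr0n/= mulr0 add0r divr_ge0// mulr_ge0// powR_ge0.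
have nu1p : 0 < 1 + nu by lra.
pose E := eps `^ (1 + nu); have E0 : 0 < E by rewrite powR_gt0.
have -> : eps `^ (nu - 1) = E / eps ^+ 2.
  by rewrite /E -powR_mulrn ?ltW// -powRB ?(gt_eqF eps0) ?implybT//; congr (_ `^ _); lra.
(* Young's inequality: the power [(1 + nu) / 2] of [(t / eps)^2] is [(t / eps)^(1 + nu)]. *)
have := @powR_le_affine R ((1 + nu) / 2) ((t / eps) ^+ 2).
have -> : ((t / eps) ^+ 2) `^ ((1 + nu) / 2) = t `^ (1 + nu) / E.
  rewrite -powR_mulrn ?divr_ge0 ?ltW// -powRrM (_ : 2%:R * _ = 1 + nu); last by field.
  by rewrite powRM ?invr_ge0 ?ltW// -powR_inv1 ?ltW// powRAC powR_inv1 ?powR_ge0.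
have /[swap] /[apply] : 0 <= (1 + nu) / 2 <= 1 by lra.
have /[swap] /[apply] : 0 < (t / eps) ^+ 2 by rewrite exprn_gt0// divr_gt0.
rewrite ler_pdivrMr// expr_div_n => H.
have C0 : 0 <= M / (1 + nu) by rewrite divr_ge0// ltW.
apply: le_trans (ler_wpM2l C0 H) _.
have -> : M / (1 + nu) * (((1 + nu) / 2 * (t ^+ 2 / eps ^+ 2) + (1 - (1 + nu) / 2)) * E)
  = M * (E / eps ^+ 2) / 2 * t ^+ 2 + M * E / 2 * ((1 - nu) / (1 + nu)).
  by field; rewrite !gt_eqF.
rewrite lerD2l; apply: ler_piMr; first by rewrite divr_ge0 ?mulr_ge0 // ltW.
by rewrite ler_pdivrMr//; lra.
Qed.

(** Inexact smoothness: [M eps^(nu - 1)] serves as [L] and [M eps^(1 + nu) / 2] as the error [e],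
    with the scale [eps] free to be tuned. *)
Lemma holder_smooth_quadratic (R : realType) m (f : 'cV[R]_m -> R) (M nu eps : R)
    (x z s : 'cV[R]_m) :
  0 <= M -> 0 <= nu <= 1 -> 0 < eps -> holder_smooth f M nu -> subdiff f z s ->
  f x <= f z + inner s (x - z)
         + M * eps `^ (nu - 1) / 2 * inner (x - z) (x - z) + M * eps `^ (1 + nu) / 2.
Proof.
move=> M0 nu01 eps0 fs /(fs x)/andP[_ H].
have := holder_power_le_quadratic M0 nu01 eps0 (enorm_ge0 (x - z)).
by rewrite enorm_sqr; lra.
Qed.

(* Minimize over u the quadratic upper bound of f at x minus the affine minorant
   of f at z; the minimizer is x + (lam - s) / L. *)
Lemma subgradient_gap (R : realType) m (f : 'cV[R]_m -> R) (x z s lam : 'cV[R]_m)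
    (L e : R) :
  0 < L ->
  (forall u, f u <= f x + inner s (u - x) + L / 2 * inner (u - x) (u - x) + e) ->
  subdiff f z lam ->
  f z + inner lam (x - z) + inner (lam - s) (lam - s) / (2 * L) <= f x + e.
Proof.
move=> L0 ub lb; pose d := lam - s.
have := ub (x + L^-1 *: d); have := lb (x + L^-1 *: d).
rewrite [x + _ - x]addrAC subrr add0r [x + _ - z]addrAC (innerDr (x - z)) !innerZr innerZl.
have -> : L / 2 * (L^-1 * (L^-1 * inner d d)) = inner d d / (2 * L).
  by field; rewrite gt_eqF.
have : L^-1 * inner lam d - L^-1 * inner s d = 2 * (inner d d / (2 * L)).
  by rewrite -mulrBr -innerNl -innerDl -/d; field; rewrite gt_eqF.
rewrite -/d; lra.
Qed.

(** * Existence of subgradients *)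

Lemma convex_funE (R : realType) m (f : 'cV[R]_m -> R) (t : R) (x y : 'cV[R]_m) :
  convex_fun f -> 0 <= t <= 1 ->
  f (t *: x + (1 - t) *: y) <= t * f x + (1 - t) * f y.
Proof.
move=> fc /andP[t0 t1].
by have := fc (Itv01 t0 t1) x y (in_setT _) (in_setT _).
Qed.

(* One step of the Hahn-Banach extension: F v = f (z + v) - f z - <s, v> is
   convex and nonnegative on V, and any c between the slopes of F on the two
   sides of V along e extends the subgradient. *)
Lemma subgradient_extend (R : realType) m (f : 'cV[R]_m -> R) (z s e : 'cV[R]_m)
    (V : set 'cV[R]_m) :
  convex_fun f -> V 0 ->
  (forall t v w, V v -> V w -> V (t *: v + (1 - t) *: w)) ->
  (forall v, V v -> f z + inner s v <= f (z + v)) ->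
  exists c : R, forall v t, V v -> f z + inner s (v + t *: e) + c * t <= f (z + (v + t *: e)).
Proof.
move=> fc V0 Vc fs; pose F v := f (z + v) - f z - inner s v.
have F0 v : V v -> 0 <= F v by move=> /fs; rewrite /F; lra.
have Fc t v w : 0 <= t <= 1 -> F (t *: v + (1 - t) *: w) <= t * F v + (1 - t) * F w.
  move=> t01; rewrite /F innerDr !innerZr.
  have -> : z + (t *: v + (1 - t) *: w) = t *: (z + v) + (1 - t) *: (z + w).
    by apply/colP => i; rewrite !mxE; ring.
  by have := convex_funE (z + v) (z + w) fc t01; lra.
have slope v t v' t' : V v -> V v' -> 0 < t -> 0 < t' ->
    - F (v - t *: e) / t <= F (v' + t' *: e) / t'.
  move=> Vv Vv' t0 t0'; have tt : 0 < t + t' by lra.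
  (* Weights inversely proportional to the step lengths cancel the components along [e], so the
     combination lies in [V], where [F] is nonnegative. *)
  have a01 : 0 <= t' / (t + t') <= 1.
    by rewrite ler_pdivrMr// mul1r divr_ge0 ?(ltW t0') ?(ltW tt)//=; lra.
  have := Fc (t' / (t + t')) (v - t *: e) (v' + t' *: e) a01.
  have -> : t' / (t + t') *: (v - t *: e) + (1 - t' / (t + t')) *: (v' + t' *: e)
    = t' / (t + t') *: v + (1 - t' / (t + t')) *: v'.
    by apply/colP => i; rewrite !mxE; field; rewrite gt_eqF.
  move=> /(le_trans (F0 _ (Vc _ _ _ Vv Vv'))).
  have -> : t' / (t + t') * F (v - t *: e) + (1 - t' / (t + t')) * F (v' + t' *: e)
    = (F (v - t *: e) / t + F (v' + t' *: e) / t') * (t * t' / (t + t')).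
    by field; rewrite !gt_eqF.
  by rewrite pmulr_lge0 ?divr_gt0 ?mulr_gt0// mulNr; lra.
pose S := [set a | exists v t, [/\ V v, 0 < t & a = - F (v - t *: e) / t]].
have Sub v t : V v -> 0 < t -> ubound S (F (v + t *: e) / t).
  by move=> Vv t0 _ [v' [t' [Vv' t0' ->]]]; exact: slope.
have S0 : S !=set0 by exists (- F (0 - 1 *: e) / 1), 0, 1.
exists (sup S) => v t Vv; suff : sup S * t <= F (v + t *: e) by rewrite /F; lra.
have [t0|t0|->] := ltgtP t 0.
- have : - F (v - (- t) *: e) / (- t) <= sup S.
    apply: ub_le_sup; first by exists (F (0 + 1 *: e) / 1); exact: Sub.
    by exists v, (- t); rewrite oppr_gt0.
  by rewrite scaleNr opprK mulNr invrN mulrN opprK ler_ndivrMr.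
- by rewrite -ler_pdivlMr//; apply: ge_sup => //; exact: Sub.
- by rewrite mulr0 scale0r addr0; exact: F0.
Qed.

(** Induction over the subspaces [V k] of vectors supported on the first [k] coordinates: the
    subgradient is extended one coordinate direction at a time, and [V m] is the whole space. *)
Lemma subdiff_nonempty (R : realType) m (f : 'cV[R]_m -> R) (z : 'cV[R]_m) :
  convex_fun f -> subdiff f z !=set0.
Proof.
move=> fc; pose V k := [set v : 'cV[R]_m | forall i : 'I_m, (k <= i)%N -> v i 0 = 0].
suff ext k : (k <= m)%N -> exists s, forall v, V k v -> f z + inner s v <= f (z + v).
  have [s Hs] := ext m (leqnn m); exists s => x.
  have := Hs (x - z); rewrite (addrC z) subrK; apply => i.
  by rewrite leqNgt ltn_ord.
elim: k => [_|k IH km].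
  exists 0 => v Vv; have -> : v = 0 by apply/colP => i; rewrite Vv ?mxE.
  by rewrite inner0r !addr0.
have [s Hs] := IH (ltnW km); pose e : 'cV[R]_m := delta_mx (Ordinal km) 0.
have eE (v : 'cV[R]_m) : inner e v = v (Ordinal km) 0.
  rewrite /inner (bigD1 (Ordinal km))//= mxE !eqxx mul1r big1 ?addr0// => i /negbTE ik.
  by rewrite mxE ik mul0r.
have V0 : V k 0 by move=> i _; rewrite mxE.
have Vc t v w : V k v -> V k w -> V k (t *: v + (1 - t) *: w).
  by move=> Vv Vw i ki; rewrite !mxE Vv ?Vw// !mulr0 addr0.
have [c Hc] := @subgradient_extend _ _ f z s e (V k) fc V0 Vc Hs.
exists (s + c *: e) => u Vu; pose t := u (Ordinal km) 0.
have := Hc (u - t *: e) t; rewrite subrK innerDl innerZl eE addrA; apply => i ki.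
rewrite !mxE andbT; have [->|ik] := eqVneq i (Ordinal km); first by rewrite mulr1 subrr.
rewrite mulr0 subr0 Vu// ltn_neqAle ki andbT.
by apply: contraNneq ik => ik; exact/eqP/val_inj.
Qed.

(** * Decrease of the potential *)

(** [a] and [b] stand for the squared dual and primal distances, [n] for the step index. The dual
    terms telescope since [(n+1)(n+2) + 4(n+2) >= (n+2)(n+3)]. *)
Lemma weighted_step_bound (R : realType) (n eta a0 a1 b0 b1 d D2 e : R) :
  0 <= n -> 0 < eta -> 0 <= a1 -> 0 <= b1 -> 0 <= d <= D2 ->
  (n + 2) * ((a0 - a1) / (2 * (4 * eta / (n + 1))) - a1 / (2 * eta)
             + eta / 2 * (b0 - b1) + 4 * eta / (n + 1) / 2 * (d - b1) + e)
  <= ((n + 1) * (n + 2) / (8 * eta) * a0 + (n + 2) * (eta / 2) * b0)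
     - ((n + 2) * (n + 3) / (8 * eta) * a1 + (n + 3) * (eta / 2) * b1)
     + 4 * eta * D2 + (n + 2) * e.
Proof.
move=> n0 eta0 a10 b10 /andP[d0 dD]; have n10 : 0 < n + 1 by lra.
(* [q >= 1] keeps the surplus multiple of [b1] nonnegative, and [q <= 2] bounds the [d] term by
   [4 eta D2]. *)
pose q := (n + 2) / (n + 1).
have q1 : 1 <= q by rewrite ler_pdivlMr//; lra.
have q2 : q <= 2 by rewrite ler_pdivrMr//; lra.
have -> : (n + 2) * ((a0 - a1) / (2 * (4 * eta / (n + 1))) - a1 / (2 * eta)
             + eta / 2 * (b0 - b1) + 4 * eta / (n + 1) / 2 * (d - b1) + e)
  = ((n + 1) * (n + 2) / (8 * eta) * a0 + (n + 2) * (eta / 2) * b0)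
     - ((n + 2) * (n + 3) / (8 * eta) * a1 + (n + 3) * (eta / 2) * b1)
     + 2 * q * eta * d + (n + 2) * e
     - ((n + 2) * a1 / (4 * eta) + eta / 2 * (4 * q - 1) * b1).
  by rewrite /q; field; rewrite !gt_eqF.
have H1 : 0 <= (n + 2) * a1 / (4 * eta) by rewrite divr_ge0 ?mulr_ge0//; lra.
have H2 : 0 <= eta / 2 * (4 * q - 1) * b1 by rewrite !mulr_ge0//; lra.
have H3 : 2 * q * eta * d <= 4 * eta * D2.
  have -> : 2 * q * eta * d = (2 * eta) * (q * d) by ring.
  have -> : 4 * eta * D2 = (2 * eta) * (2 * D2) by ring.
  by rewrite ler_pM2l ?mulr_gt0// ler_pM//; lra.
lra.
Qed.

Definition potential (R : realType) m (lam w : 'cV[R]_m) (eta : R)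
    (x l : nat -> 'cV[R]_m) (k : nat) : R :=
  (k%:R + 1) * (k%:R + 2) / (8 * eta) * inner (lam - l k) (lam - l k)
  + (k%:R + 2) * (eta / 2) * inner (x k - w) (x k - w).

(** The step identity is added to the gap inequality for [lam], the subgradient inequality at [x k]
    and the oracle bound on [gap]. As [L <= eta], the term [|lam - s k|^2 / (2 eta)] is absorbed by
    [|lam - s k|^2 / (2 L)]. *)
Lemma potential_step (R : realType) m (f : 'cV[R]_m -> R) (L e eta D2 : R)
    (lam w w' wbar : 'cV[R]_m) (x l s : nat -> 'cV[R]_m) (k : nat) (gap : R) :
  0 < L <= eta ->
  (forall u, f u <= f (x k) + inner (s k) (u - x k)
                    + L / 2 * inner (u - x k) (u - x k) + e) ->
  subdiff f wbar lam -> subdiff f (x k) (s k) ->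
  inner (w' - w) (w' - w) <= D2 ->
  argmin setT (fun u : 'cV[R]_m =>
      inner (s k - l k) u + eta / 2 * enorm (u - x k) ^+ 2
      + 4 * eta / k.+1%:R / 2 * enorm (w' - u) ^+ 2) (x k.+1) ->
  l k.+1 = l k + (4 * eta / k.+1%:R) *: (w' - x k.+1) ->
  gap <= inner (l k) (w - w') ->
  (k%:R + 2) * (f wbar - f w + gap - inner lam (wbar - w'))
  <= potential lam w eta x l k - potential lam w eta x l k.+1
     + 4 * eta * D2 + (k%:R + 2) * e.
Proof.
move=> /andP[L0 Leta] ub lamP sP wD xP lP gapP; have eta0 : 0 < eta by lra.
have k0 : 0 <= k%:R :> R by [].
have rho0 : 0 < 4 * eta / k.+1%:R by rewrite divr_gt0 ?mulr_gt0.
have step := splitting_step_gap lam w eta0 rho0 lP (prox_optimality xP).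
have sg := subgradient_gap L0 ub lamP.
have lb := sP w.
set N1 := inner (lam - s k) (lam - s k) in step sg.
have N1L : N1 / (2 * eta) <= N1 / (2 * L).
  by rewrite ler_wpM2l ?inner_ge0// lef_pV2 ?posrE ?mulr_gt0// ler_pM2l.
rewrite /potential -[k.+1%:R]natr1.
have -> : k%:R + 1 + 1 = k%:R + 2 :> R by ring.
have -> : k%:R + 1 + 2 = k%:R + 3 :> R by ring.
have wD' : 0 <= inner (w' - w) (w' - w) <= D2 by rewrite inner_ge0.
have := @weighted_step_bound _ _ _ (inner (lam - l k) (lam - l k)) _
   (inner (x k - w) (x k - w)) _ _ _ e k0 eta0
   (inner_ge0 (lam - l k.+1)) (inner_ge0 (x k.+1 - w)) wD'.
apply: le_trans; rewrite ler_pM2l ?ltr_wpDl//.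
move: step; rewrite -[k.+1%:R]natr1 => <-; move: sg lb gapP.
by rewrite !inner_bilin; lra.
Qed.

(** * Jensen's inequality and the linear minimization oracle *)

Lemma convex_efun_le (R : realType) n (g : 'cV[R]_n -> \bar R) (t a c : R)
    (u v : 'cV[R]_n) :
  convex_efun g -> 0 <= t <= 1 -> (g u <= a%:E)%E -> (g v <= c%:E)%E ->
  (g (t *: u + (1 - t) *: v)%R <= (t * a + (1 - t) * c)%:E)%E.
Proof.
move=> gc /andP[t0 t1] ua vc.
by have /set_mem := gc (u, a) (v, c) (Itv01 t0 t1) (mem_set ua) (mem_set vc).
Qed.

(** Jensen's inequality by induction, splitting off the last point. The real majorants [G] keep the
    argument inside the epigraph. *)
Lemma convex_efun_mean (R : realType) n (g : 'cV[R]_n -> \bar R) (K : nat)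
    (al G : nat -> R) (y : nat -> 'cV[R]_n) :
  convex_efun g -> (forall i, 0 < al i) ->
  (forall i, (i < K.+1)%N -> (g (y i) <= (G i)%:E)%E) ->
  (g ((\sum_(0 <= i < K.+1) al i)^-1 *: \sum_(0 <= i < K.+1) al i *: y i)%R
   <= ((\sum_(0 <= i < K.+1) al i)^-1 * \sum_(0 <= i < K.+1) al i * G i)%:E)%E.
Proof.
move=> gc al0; elim: K => [|K IH] gG.
  by rewrite !big_nat1 scalerA mulVf ?gt_eqF// scale1r mulKf ?gt_eqF//; exact: gG.
rewrite !(big_nat_recr K.+1)//=; set S := \sum_(0 <= i < K.+1) al i.
have S0 : 0 < S.
  by rewrite /S big_nat_recl// ltr_wpDr// sumr_ge0// => i _; exact: ltW.
have a0 := al0 K.+1; have Sa0 : 0 < S + al K.+1 by rewrite addr_gt0.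
set Y := \sum_(0 <= i < K.+1) _; set Z := \sum_(0 <= i < K.+1) _.
have := @convex_efun_le _ _ g (S / (S + al K.+1)) (S^-1 * Z) (G K.+1) (S^-1 *: Y) (y K.+1) gc.
have -> : S / (S + al K.+1) *: (S^-1 *: Y) + (1 - S / (S + al K.+1)) *: y K.+1
   = (S + al K.+1)^-1 *: (Y + al K.+1 *: y K.+1).
  rewrite scalerDr !scalerA; congr (_ *: _ + _ *: _); first by field; rewrite !gt_eqF.
  by field; rewrite gt_eqF.
have -> : S / (S + al K.+1) * (S^-1 * Z) + (1 - S / (S + al K.+1)) * G K.+1
   = (S + al K.+1)^-1 * (Z + al K.+1 * G K.+1) by field; rewrite !gt_eqF.
apply.
- by rewrite divr_ge0 ?(ltW S0) ?(ltW Sa0)//= ler_pdivrMr// mul1r lerDl ltW.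
- by apply: IH => i iK; apply: gG; rewrite ltnS ltnW.
- exact: gG.
Qed.

Lemma edom_fineK (R : realType) T (g : T -> \bar R) (y : T) :
  proper_efun g -> edom g y -> (fine (g y))%:E = g y.
Proof.
move=> [gN _] yd; rewrite fineK// fin_numE gN/=.
by rewrite -ltey.
Qed.

(** The finite value at [v] bounds the minimum, so the minimizer lies in the domain and the
    comparison can be made in the reals. *)
Lemma lmo_step (R : realType) n m (A : {linear 'cV[R]_n -> 'cV[R]_m})
    (g : 'cV[R]_n -> \bar R) (l : 'cV[R]_m) (y v : 'cV[R]_n) :
  proper_efun g -> edom g v ->
  argmin setT (fun u => (g u + (inner l (A u))%:E)%E) y ->
  edom g y /\ fine (g y) - fine (g v) <= inner l (A v - A y).
Proof.
move=> gp vd [_ /(_ v I) opt].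
have yd : edom g y.
  rewrite /edom/= ltey; apply/eqP => gy; move: opt; rewrite gy -(edom_fineK gp vd) -EFinD addye//.
split=> //; move: opt; rewrite -(edom_fineK gp vd) -(edom_fineK gp yd) -!EFinD lee_fin.
by rewrite innerDr innerNr; lra.
Qed.

(** * Rate of a single run *)

Lemma sum_averaging_weights (R : realType) K :
  \sum_(0 <= i < K) (i + 2)%:R = K%:R * (K%:R + 3) / 2 :> R.
Proof.
elim: K => [|K IH]; first by rewrite big_geq// mul0r mul0r.
by rewrite big_nat_recr//= IH natrD -[K.+1%:R]natr1; field.
Qed.

(** The numerator is the bound on the initial potential plus [K] step errors [4 eta D2]; the
    denominator is the sum of the weights. The weighted errors [e] average to the final [e]. *)
Lemma splitting_rate (R : realType) n m (A : {linear 'cV[R]_n -> 'cV[R]_m})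
    (f : 'cV[R]_m -> R) (g : 'cV[R]_n -> \bar R) (L e eta D2 : R)
    (y0 v ybar : 'cV[R]_n) (K : nat) :
  convex_fun f -> proper_efun g -> convex_efun g -> 0 < L <= eta -> 0 <= e ->
  (forall x z s, subdiff f z s ->
     f x <= f z + inner s (x - z) + L / 2 * inner (x - z) (x - z) + e) ->
  (forall u w, edom g u -> edom g w -> inner (A u - A w) (A u - A w) <= D2) ->
  edom g y0 -> edom g v -> (0 < K)%N ->
  splitting_output A f g (fun=> eta) (fun k => 4 * eta / k.+1%:R) y0 K ybar ->
  (objective A f g ybar
   <= objective A f g v
      + ((L * D2 / 4 + e + eta * D2 + K%:R * (4 * eta * D2)) / (K%:R * (K%:R + 3) / 2)
         + e)%:E)%E.
Proof.
move=> fc gp gc /andP[L0 Leta] e0 ub Ddom y0d vd K0 [y [x [l [s [run ybarE]]]]].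
have eta0 : 0 < eta by lra.
pose G u := fine (g u).
have lmo k (kK : (k < K)%N) := lmo_step gp vd (run_y run kK).
pose S : R := K%:R * (K%:R + 3) / 2.
have KR : 0 < K%:R :> R by rewrite ltr0n.
have S0 : 0 < S by rewrite divr_gt0// mulr_gt0//; lra.
have jens : (g ybar <= (S^-1 * \sum_(0 <= i < K) (i + 2)%:R * G (y i.+1))%:E)%E.
  rewrite ybarE /averaged_output /S -sum_averaging_weights.
  case: K K0 lmo {run ybarE KR S S0} => // K _ lmo.
  apply: (@convex_efun_mean _ _ _ _ (fun i => (i + 2)%:R) (fun i => G (y i.+1))
    (fun i => y i.+1)) => // i iK.
  by rewrite /G edom_fineK//; case: (lmo i iK).
have ybard : edom g ybar by exact: (le_lt_trans jens (ltry _)).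
have [lam lamP] := subdiff_nonempty (A ybar) fc.
pose wbar := A ybar; pose w := A v.
pose Phi := potential lam w eta x l.
have step k : (k < K)%N ->
  (k%:R + 2) * (f wbar - f w + (G (y k.+1) - G v) - inner lam (wbar - A (y k.+1)))
  <= Phi k - Phi k.+1 + 4 * eta * D2 + (k%:R + 2) * e.
  move=> kK; have [yd gapP] := lmo k kK.
  apply: (@potential_step _ _ f L e eta D2 lam w (A (y k.+1)) wbar x l s k) => //.
  - by rewrite L0.
  - by move=> u; apply: ub; exact: (run_s run kK).
  - exact: (run_s run kK).
  - exact: Ddom.
  - exact: (run_x run kK).
  - exact: (run_l run kK).
have PhiK : 0 <= Phi K by rewrite addr_ge0// !mulr_ge0 ?invr_ge0 ?inner_ge0//; lra.
(* The upper bound of [f] around [wbar] and the gap inequality at [x 0] together give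
   [|lam - l 0|^2 / (2 L) <= L D2 / 2 + 2 e]; [L <= eta] then controls the dual term. *)
have Phi0 : Phi 0 <= L * D2 / 4 + e + eta * D2.
  have xw : inner (x 0 - w) (x 0 - w) <= D2 by rewrite (run_x0 run); apply: Ddom.
  have xwbar : inner (x 0 - wbar) (x 0 - wbar) <= D2 by rewrite (run_x0 run); apply: Ddom.
  have := subgradient_gap L0 (fun u => ub u (x 0) (l 0) (run_l0 run)) lamP.
  have := ub (x 0) wbar lam lamP.
  rewrite /Phi /potential; set N := inner (lam - l 0) (lam - l 0) => H1 H2.
  have N0 : 0 <= N := inner_ge0 _.
  have HN : N / (2 * L) <= L / 2 * D2 + 2 * e.
    have : L / 2 * inner (x 0 - wbar) (x 0 - wbar) <= L / 2 * D2 by rewrite ler_pM2l ?divr_gt0.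
    by rewrite /wbar in H1 *; lra.
  have HN1 : N <= L * (L * D2 + 4 * e) by move: HN; rewrite ler_pdivrMr ?mulr_gt0//; lra.
  have D0 : 0 <= D2 by apply: le_trans xw; exact: inner_ge0.
  have B0 : 0 <= L * D2 + 4 * e by rewrite addr_ge0// ?mulr_ge0//; lra.
  have HN2 : N <= eta * (L * D2 + 4 * e) by apply: le_trans HN1 _; rewrite ler_wpM2r.
  have -> : (0%:R + 1) * (0%:R + 2) / (8 * eta) * N = (N / eta) / 4 by field; rewrite gt_eqF.
  have : N / eta <= L * D2 + 4 * e by rewrite ler_pdivrMr// mulrC.
  have : eta * inner (x 0 - w) (x 0 - w) <= eta * D2 by rewrite ler_pM2l.
  lra.
have total : S * (f wbar - f w - G v - e) + \sum_(0 <= i < K) (i + 2)%:R * G (y i.+1)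
  <= Phi 0 - Phi K + K%:R * (4 * eta * D2).
  (* [lam] does not depend on [i], so the sum moves inside [inner lam (A _)], where the weighted
     deviations from the mean vanish. *)
  have lam0 : \sum_(0 <= i < K) (i + 2)%:R * inner lam (wbar - A (y i.+1)) = 0.
    have -> : \sum_(0 <= i < K) (i + 2)%:R * inner lam (wbar - A (y i.+1))
      = inner lam (A (\sum_(0 <= i < K) (i + 2)%:R *: (ybar - y i.+1))).
      rewrite linear_sum inner_sumr; apply: eq_bigr => i _.
      by rewrite linearZ/= innerZr linearB.
    rewrite (_ : \sum_(0 <= i < K) _ = 0) ?linear0 ?inner0r//.
    under eq_bigr do rewrite scalerBr.
    rewrite sumrB -scaler_suml ybarE /averaged_output scalerA divff ?scale1r ?subrr//.
    by rewrite sum_averaging_weights gt_eqF.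
  have : \sum_(0 <= k < K) ((k + 2)%:R * (f wbar - f w + (G (y k.+1) - G v)
             - inner lam (wbar - A (y k.+1))) - (k + 2)%:R * e)
      <= \sum_(0 <= k < K) (Phi k - Phi k.+1 + 4 * eta * D2).
    rewrite !big_nat; apply: ler_sum => k /andP[_ kK].
    by have := step k kK; rewrite natrD; lra.
  have -> : \sum_(0 <= k < K) (Phi k - Phi k.+1 + 4 * eta * D2)
      = Phi 0 - Phi K + K%:R * (4 * eta * D2).
    rewrite big_split/= sumr_const_nat subn0 -[_ *+ K]mulr_natl; congr (_ + _).
    by rewrite -[RHS]opprB -telescope_sumr// -sumrN; apply: eq_bigr => k _; rewrite opprB.
  apply: le_trans; rewrite -[leLHS]subr0 -[X in _ - X]lam0 /S -sum_averaging_weights mulr_suml.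
  rewrite -big_split/= -sumrB; apply: ler_sum => k _; lra.
move: jens; rewrite /objective -(edom_fineK gp ybard) -(edom_fineK gp vd) -!EFinD !lee_fin.
rewrite -/(G ybar) -/(G v) -/S mulrC ler_pdivlMr// => jens.
suff : S * (f wbar + G ybar - (f w + G v) - e)
    <= L * D2 / 4 + e + eta * D2 + K%:R * (4 * eta * D2).
  by rewrite mulrC -ler_pdivlMr// /wbar /w; lra.
lra.
Qed.

(** * Budget estimates and the dyadic grid *)

Lemma ln2_gt0 (R : realType) : 0 < ln 2 :> R.
Proof. by rewrite ln_gt0// ltr1n. Qed.

Lemma ln2_ge_half (R : realType) : 1 / 2 <= ln 2 :> R.
Proof.
have := @le_ln1Dx R (- (1 / 2)); have -> : 1 + - (1 / 2) = 2^-1 :> R by field.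
by rewrite lnV ?posrE//; lra.
Qed.

Lemma ln8 (R : realType) : ln 8 = 3 * ln 2 :> R.
Proof.
have -> : 8 = 2 ^+ 3 :> R by rewrite -natrX.
by rewrite lnXn// mulr_natl.
Qed.

Lemma powR_root_le (R : realType) (a p x : R) :
  0 < a -> 0 < p -> a `^ (1 / p) <= x -> ln a <= p * ln x.
Proof.
move=> a0 p0 h; have x0 : 0 < x by apply: lt_le_trans h; rewrite powR_gt0.
have : ln (a `^ (1 / p)) <= ln x by rewrite ler_ln ?posrE ?powR_gt0.
by rewrite ln_powR mulrAC mul1r ler_pdivrMr// mulrC.
Qed.

Lemma budget_base_ge (R : realType) (b : R) : 2 <= b -> 24 <= 4 * b * log2 (4 * b).
Proof.
move=> b2; have l3 : 3 <= log2 (4 * b).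
  by rewrite /log2 ler_pdivlMr ?ln2_gt0// -ln8 ler_ln ?posrE; lra.
have -> : 24 = 8 * 3 :> R by rewrite -natrM.
by apply: ler_pM => //; lra.
Qed.

(* The tangent bound ln x <= x / c + ln c - 1 at c = 4 b. *)
Lemma budget_dominates_log (R : realType) (b x : R) :
  2 <= b -> 4 * b * log2 (4 * b) <= x -> 0 < x -> b * log2 x <= x.
Proof.
move=> b2 bx x0; have c0 : 0 < 4 * b by lra.
have l20 := ln2_gt0 R; have l2h := ln2_ge_half R.
have tangent : ln x - ln (4 * b) <= x / (4 * b) - 1.
  rewrite -ln_div ?posrE// -{1}(subrK 1 (x / (4 * b))) addrC.
  by apply: le_ln1Dx; rewrite ltrBDr addrC subrr divr_gt0.
rewrite /log2 mulrA ler_pdivrMr//.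
move: bx; rewrite /log2 mulrA ler_pdivrMr// => bx.
have b0 : 0 <= b by lra.
have := ler_wpM2l b0 tangent.
have -> : b * (x / (4 * b) - 1) = x / 4 - b by field; rewrite gt_eqF//; lra.
have : x * (1 / 2) <= x * ln 2 by rewrite ler_pM2l.
lra.
Qed.

(** With [q = b log2 N], the threshold gives [N / q >= 1], hence [K >= 1]. Then
    [N / q < K + 1 <= 2 K], which is the source of the factor 2 in the last bound. *)
Lemma search_iters_bounds (R : realType) (b : R) (N : nat) :
  2 <= b -> 4 * b * log2 (4 * b) <= N%:R ->
  let K := search_iters N b in
  [/\ (0 < K)%N, K%:R <= N%:R :> R, b * log2 N%:R <= N%:R / K%:R
    & K%:R^-1 <= 2 * b * log2 N%:R / N%:R].
Proof.
move=> b2 bN K.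
have N24 : 24 <= N%:R :> R := le_trans (budget_base_ge b2) bN.
have N0 : 0 < N%:R :> R by lra.
have l1 : 1 <= log2 (N%:R : R).
  by rewrite /log2 ler_pdivlMr ?ln2_gt0// mul1r ler_ln ?posrE; lra.
have bl2 : 2 * 1 <= b * log2 N%:R by apply: ler_pM => //; lra.
set q := b * log2 N%:R in bl2 *; have q0 : 0 < q by lra.
have qN : 1 <= N%:R / q by rewrite ler_pdivlMr// mul1r; exact: budget_dominates_log.
have /andP[Kle Klt] : K%:R <= N%:R / q < K.+1%:R.
  by apply: truncn_itv; exact: le_trans ler01 qN.
have K0 : (0 < K)%N by rewrite lt0n; apply: contraTneq Klt => ->; rewrite -leNgt.
have KR : 1 <= K%:R :> R by rewrite ler1n.
have KR0 : 0 < K%:R :> R by lra.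
split => //.
- by apply: le_trans Kle _; rewrite ler_pdivrMr// ler_peMr//; lra.
- by rewrite ler_pdivlMr// mulrC -ler_pdivlMr.
- rewrite -[2 * b * _]mulrA -/q ler_pdivlMr// mulrC ler_pdivrMr; last by lra.
  by move: Klt; rewrite ltr_pdivrMr// -natr1 => /ltW/le_trans; apply; nra.
Qed.

(** The exponent is [floor (log2 c) + 1]; the margin 1 in [Y - 1] pays for this rounding up. *)
Lemma dyadic_scale (R : realType) (c Y : R) :
  0 < c -> `|ln c / ln 2| <= Y - 1 ->
  exists2 j : int, - Num.floor Y <= j <= Num.floor Y & c <= 2 ^ j <= 2 * c.
Proof.
move=> c0; set x := ln c / ln 2; rewrite ler_norml => /andP[xl xu].
have l20 := ln2_gt0 R; have xE : ln c = x * ln 2 by rewrite /x mulfVK ?gt_eqF.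
have := floor_le x; have := floorD1_gt x; have := floorD1_gt Y.
move: (Num.floor x) (Num.floor Y) => k s; rewrite !intrD => Ys xk kx.
have lk : ln (2 ^ (k + 1) : R) = (k%:~R + 1) * ln 2.
  by rewrite -powR_intmul// ln_powR intrD.
have kl : k%:~R * ln 2 <= x * ln 2 by rewrite ler_pM2r.
exists (k + 1).
  by rewrite -!ltzD1 -!(ltr_int R) !intrD rmorphN/=; apply/andP; split; lra.
rewrite -ler_ln ?posrE ?exprz_gt0// -[X in _ && X]ler_ln ?posrE ?mulr_gt0 ?exprz_gt0//.
rewrite lnM ?posrE// lk xE ler_pM2r// (ltW xk)/=; lra.
Qed.

(** The second term of the threshold bounds [log2 L] above and the third bounds it below, both by
    [(N / K - 3) / 2]. The factor 8 supplies the 3: one from [N / K - 1] in the radius, two from the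
    rounding margin. *)
Lemma search_scale (R : realType) (b nu r : R) (N : nat) :
  2 <= b -> 0 <= nu <= 1 -> 0 < r -> budget_threshold b nu r <= N%:R ->
  let K := search_iters N b in let s := search_radius N b in
  let L := r * (K%:R^-1) `^ ((nu - 1) / 2) in
  exists2 j : int, - s <= j <= s & L <= 2 ^ j <= 2 * L.
Proof.
move=> b2 /andP[nu0 nu1] r0 thr K s L.
move: thr; rewrite /budget_threshold !ge_max => /and3P[bN N1 N2].
have [K0 KN bNK _] := search_iters_bounds b2 bN; rewrite -/K in K0 KN bNK.
have KR : 0 < K%:R :> R by rewrite ltr0n.
have r2 : 0 < r ^+ 2 by rewrite exprn_gt0.
have l20 := ln2_gt0 R.
have p1 : 0 < b - 1 + nu by lra.
have p2 : 0 < b by lra.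
have := powR_root_le (mulr_gt0 (ltr0n _ 8) r2) p1 N1.
have := powR_root_le (divr_gt0 (ltr0n _ 8) r2) p2 N2.
rewrite ln_div ?posrE// [ln (8 * _)]lnM ?posrE// !lnXn// ln8 => H2 H1.
have KNl : (1 - nu) * ln K%:R <= (1 - nu) * ln N%:R.
  by rewrite ler_wpM2l ?subr_ge0// ler_ln ?posrE// (lt_le_trans KR).
have Kl : 0 <= (1 - nu) * ln K%:R by rewrite mulr_ge0 ?subr_ge0// ln_ge0// ler1n.
have lL : ln L = ln r + (1 - nu) / 2 * ln K%:R.
  by rewrite /L lnM ?posrE ?powR_gt0 ?invr_gt0// ln_powR lnV ?posrE//; lra.
apply: dyadic_scale; first by rewrite mulr_gt0 ?powR_gt0 ?invr_gt0.
have lN : b * ln N%:R <= N%:R / K%:R * ln 2.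
  by move: bNK; rewrite /log2 mulrA ler_pdivrMr.
rewrite -/K normrM [`|_^-1|]gtr0_norm ?invr_gt0// ler_pdivrMr// ler_norml lL.
by apply/andP; split; lra.
Qed.

(** * Diameter, Hölder rate and the parameter search *)

Lemma ediam_ge (R : realType) n (S : set 'cV[R]_n) (u v : 'cV[R]_n) :
  ebounded S -> S u -> S v -> enorm (u - v) <= ediam S.
Proof.
move=> [C SC] Su Sv; apply: ub_le_sup; last by exists u, v.
(* [|x - z|^2 <= 2 |x|^2 + 2 |z|^2 <= 4 C^2], so the supremum is a genuine upper bound. *)
exists (2 * C) => _ [x [z [Sx Sz ->]]].
have C0 : 0 <= C := le_trans (enorm_ge0 x) (SC x Sx).
rewrite -(@ler_pXn2r _ 2) ?nnegrE ?enorm_ge0 ?mulr_ge0// enorm_sqr.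
have : enorm x ^+ 2 <= C ^+ 2 by rewrite ler_pXn2r ?nnegrE ?enorm_ge0 ?SC.
have : enorm z ^+ 2 <= C ^+ 2 by rewrite ler_pXn2r ?nnegrE ?enorm_ge0 ?SC.
have := inner_ge0 (x + z); rewrite !enorm_sqr exprMn -natrX !inner_bilin; lra.
Qed.

(* L is the Young constant of the Hoelder bound at the scale eps = D / sqrt K, which
   balances the smoothness and inexactness errors: L D^2 = K T and e = T / 2. *)
Lemma splitting_rate_holder (R : realType) n m (A : {linear 'cV[R]_n -> 'cV[R]_m})
    (f : 'cV[R]_m -> R) (g : 'cV[R]_n -> \bar R) (M nu eta D : R)
    (y0 v ybar : 'cV[R]_n) (K : nat) :
  convex_fun f -> proper_efun g -> convex_efun g -> holder_smooth f M nu ->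
  0 < M -> 0 <= nu <= 1 -> 0 < D ->
  (forall u w, edom g u -> edom g w -> enorm (A u - A w) <= D) ->
  edom g y0 -> edom g v -> (0 < K)%N ->
  let L := M * D `^ (nu - 1) * (K%:R^-1) `^ ((nu - 1) / 2) in
  L <= eta <= 2 * L ->
  splitting_output A f g (fun=> eta) (fun k => 4 * eta / k.+1%:R) y0 K ybar ->
  (objective A f g ybar
   <= objective A f g v
      + (17 * (M * D `^ (nu + 1) * (K%:R^-1) `^ ((1 + nu) / 2)))%:E)%E.
Proof.
move=> fc gp gc fs M0 nu01 D0 AD y0d vd K0 L /andP[Leta eta2L] run.
have KR : 1 <= K%:R :> R by rewrite ler1n.
have KR0 : 0 < K%:R :> R by lra.
have kap0 : 0 < K%:R^-1 :> R by rewrite invr_gt0.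
set T := M * D `^ (nu + 1) * _; have T0 : 0 < T by rewrite !mulr_gt0 ?powR_gt0.
pose eps := D * (K%:R^-1) `^ (1 / 2).
have eps0 : 0 < eps by rewrite mulr_gt0 ?powR_gt0.
have L0 : 0 < L by rewrite !mulr_gt0 ?powR_gt0.
have Leps : M * eps `^ (nu - 1) = L.
  rewrite /eps powRM ?powR_ge0 ?(ltW D0)// -powRrM mulrA; congr (_ * _ `^ _); lra.
have Teps : M * eps `^ (1 + nu) / 2 = T / 2.
  rewrite /eps powRM ?powR_ge0 ?(ltW D0)// -powRrM mulrA /T (addrC nu).
  by congr (_ * _ `^ _ / 2); lra.
have LD : L * D ^+ 2 = K%:R * T.
  rewrite /L /T (_ : nu + 1 = (nu - 1) + 2%:R); last by ring.
  rewrite (_ : (1 + nu) / 2 = (nu - 1) / 2 + 1); last by field.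
  rewrite [D `^ (nu - 1 + _)]powRD ?(gt_eqF D0) ?implybT// powR_mulrn ?(ltW D0)//.
  rewrite [_ `^ (_ + 1)]powRD ?(gt_eqF kap0) ?implybT// powRr1 ?(ltW kap0)//.
  by field; rewrite gt_eqF.
have ub x z s : subdiff f z s ->
    f x <= f z + inner s (x - z) + L / 2 * inner (x - z) (x - z) + T / 2.
  by move=> sz; have := holder_smooth_quadratic x (ltW M0) nu01 eps0 fs sz; rewrite Leps Teps.
have AD2 u w : edom g u -> edom g w -> inner (A u - A w) (A u - A w) <= D ^+ 2.
  by move=> ud wd; rewrite -enorm_sqr ler_pXn2r ?nnegrE ?enorm_ge0 ?(ltW D0)// AD.
have L0eta : 0 < L <= eta by rewrite L0.
have T20 : 0 <= T / 2 by lra.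
apply: le_trans (splitting_rate fc gp gc L0eta T20 ub AD2 y0d vd K0 run) _.
apply: leeD2l; rewrite lee_fin.
have etaD : eta * D ^+ 2 <= 2 * (K%:R * T).
  by rewrite -LD mulrA ler_pM2r ?exprn_gt0.
have KetaD : K%:R * (4 * eta * D ^+ 2) <= K%:R * (8 * (K%:R * T)).
  by rewrite ler_pM2l// -mulrA; lra.
(* The quotient costs [16 T] and the outer error [T / 2], within the total of [17 T]. *)
suff : (L * D ^+ 2 / 4 + T / 2 + eta * D ^+ 2 + K%:R * (4 * eta * D ^+ 2))
    / (K%:R * (K%:R + 3) / 2) <= 16 * T by lra.
rewrite ler_pdivrMr ?divr_gt0 ?mulr_gt0 ?addr_gt0// LD.
have TK : 1 * T <= K%:R * T by rewrite ler_pM2r.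
lra.
Qed.

Theorem theorem4p1 (R : realType) (n m : nat)
    (A : {linear 'cV[R]_n -> 'cV[R]_m})
    (g : 'cV[R]_n -> \bar R) (f : 'cV[R]_m -> R) (M nu b : R)
    (g_proper : proper_efun g) (g_closed : closed_efun g) (g_convex : convex_efun g)
    (g_lmo : lmo_solvable g)
    (dom_bounded : ebounded (A @` edom g))
    (f_convex : convex_fun f) (M_gt0 : 0 < M) (nu01 : 0 <= nu <= 1)
    (f_smooth : holder_smooth f M nu)
    (b_ge2 : 2 <= b) :
  let D := ediam (A @` edom g) in
  let r := M * D `^ (nu - 1) in
  0 < D ->
  24 <= budget_threshold b nu r /\
  forall (N : nat) (y0 yhat : 'cV[R]_n),
    budget_threshold b nu r <= N%:R ->
    edom g y0 ->
    search_output A f g y0 N b yhat ->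
    (objective A f g yhat - optimal_value A f g
     <= (262 * M * D `^ (nu + 1)
         * (2 * b * log2 N%:R / N%:R) `^ ((1 + nu) / 2))%:E)%E.
Proof.
move=> D r D0; have bt := budget_base_ge b_ge2.
split=> [|N y0 yhat thr y0d [ybar [runs [js [_ best] ->]]]].
  by rewrite /budget_threshold le_max bt.
have bN : 4 * b * log2 (4 * b) <= N%:R.
  by move: thr; rewrite /budget_threshold ge_max => /andP[].
have [K0 _ _ Kinv] := search_iters_bounds b_ge2 bN.
have r0 : 0 < r by rewrite mulr_gt0 ?powR_gt0.
have [j jP jL] := search_scale b_ge2 nu01 r0 thr.
set E := (X in (_ <= X%:E)%E); rewrite lee_subel_addr//.
rewrite -leeBlDl//; apply: le_ereal_inf_tmp => _ [v _ <-]; rewrite leeBlDl//.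
(* The selected output is at least as good as that of the well-scaled index [j], which is compared
   with an arbitrary [v]; outside the domain the value at [v] is infinite. *)
apply: le_trans (best j jP) _; rewrite addeC.
have [vd|] := boolP (g v < +oo)%E; last first.
  by rewrite ltey negbK => /eqP gv; rewrite /objective gv addey// addye// leey.
have AD u w : edom g u -> edom g w -> enorm (A u - A w) <= D.
  by move=> ud wd; apply: ediam_ge.
apply: le_trans (splitting_rate_holder f_convex g_proper g_convex f_smooth M_gt0 nu01
  D0 AD y0d vd K0 jL (runs j jP)) _.
(* It remains to use [17 <= 262] and [1 / K <= 2 b log2 N / N], the latter under a nonnegative
   power. *)
apply: leeD2l; rewrite lee_fin /E -!mulrA; apply: ler_pM => //.
- by rewrite !mulr_ge0 ?powR_ge0 ?ltW.
- by rewrite ler_nat.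
rewrite !ler_pM2l ?powR_gt0//; rewrite -!mulrA in Kinv; apply: ge0_ler_powR => //.
- by case/andP: nu01; lra.
- by rewrite nnegrE invr_ge0.
- by rewrite nnegrE (le_trans _ Kinv) ?invr_ge0.
Qed.
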